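(* Define groups $G_i$, $i\ge 1$, recursively by $G_1=\mathbb{Z}$ and $G_{i+1}=\mathbb{Z}\wr G_i$. Then for every integer $i\ge 1$ there exists a simple random walk on $G_i$ whose drift satisfies $$L_n^{G_i}\asymp n^{1-\frac{1}{2^i}}.$$
   Context: Wreath product: for groups $A,B$, the wreath product $A\wr B$ is the semidirect product of $A$ and $\sum_A B$, where $\sum_A B$ is the group of finitely supported functions $f:A\to B$ under pointwise multiplication, and $A$ acts on it by shifts: $f^a(x)=f(xa^{-1})$ for $a,x\in A$. Concretely, elements are pairs $(a,f)$ with $(a,f)(b,g)=(ab,f^b g)$. (So in $\mathbb{Z}\wr G$ the functions go from $\mathbb{Z}$ to $G$.) The wreath product of finitely generated groups is finitely generated. Simple random walk: a random walk on a finitely generated group $G$, started at the identity, whose step distribution $\mu$ is the uniform probability measure on some finite symmetric generating set of $G$. Drift: for a probability measure $\mu$ on $G$, $L_n=L_n^G=\mathrm{E}_{\mu^{*n}}\, l(g)=\sum_{g\in G} l(g)\,\mu^{*n}(g)$, where $\mu^{*n}$ is the $n$-th convolution power of $\mu$ and $l$ is the word length on $G$ with respect to a fixed finite generating set (changing the generating set changes $L_n$ only up to bounded multiplicative constants). Notation: $f(n)\asymp g(n)$ means there are constants $c,C>0$ with $c\,g(n)\le f(n)\le C\,g(n)$ for all sufficiently large $n$. *)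

(* Defs.v *)
From HB Require Import structures.
From mathcomp Require Import all_boot all_order all_algebra finmap.
From mathcomp Require Import all_classical all_reals all_analysis.

Set Implicit Arguments.
Unset Strict Implicit.
Unset Printing Implicit Defensive.

Import Order.TTheory GRing.Theory Num.Theory.
Import numFieldNormedType.Exports.

Local Open Scope ring_scope.
Local Open Scope fset_scope.

Section WreathProduct.
Variables A B : groupType.

Definition wreath : Type := (A * {fsfun A -> B with 1%g})%type.

HB.instance Definition _ := Choice.copy wreath (A * {fsfun A -> B with 1%g})%type.

Implicit Types (f g : {fsfun A -> B with 1%g}) (a x : A).

(* f^a *)
Definition fs_shift f a : {fsfun A -> B with 1%g} :=
  [fsfun x in [fset (y * a)%g | y in finsupp f] => f (x * a^-1)%g | 1%g].

Definition fs_mul f g : {fsfun A -> B with 1%g} :=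
  [fsfun x in finsupp f `|` finsupp g => (f x * g x)%g | 1%g].

Definition fs_inv f : {fsfun A -> B with 1%g} :=
  [fsfun x in finsupp f => (f x)^-1%g | 1%g].

Definition fs_one : {fsfun A -> B with 1%g} := [fsfun with 1%g].

Lemma fs_shiftE f a x : fs_shift f a x = f (x * a^-1)%g.
Proof.
rewrite /fs_shift fsfunE; case: ifPn => // xNf.
rewrite fsfun_dflt //; apply: contra xNf => xf.
by apply/imfsetP; exists (x * a^-1)%g => //=; rewrite mulgVK.
Qed.

Lemma fs_mulE f g x : fs_mul f g x = (f x * g x)%g.
Proof.
rewrite /fs_mul fsfunE in_fsetU; case: ifPn => //.
by rewrite negb_or => /andP[xf xg]; rewrite !fsfun_dflt // mulg1.
Qed.

Lemma fs_invE f x : fs_inv f x = (f x)^-1%g.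
Proof. by rewrite /fs_inv fsfunE; case: finsuppP; rewrite ?invg1. Qed.

Lemma fs_oneE x : fs_one x = 1%g.
Proof. by rewrite /fs_one fsfunE. Qed.

Let fsE := (fs_shiftE, fs_mulE, fs_invE, fs_oneE).

Definition wreath_mul (u v : wreath) : wreath :=
  ((u.1 * v.1)%g, fs_mul (fs_shift u.2 v.1) v.2).

Definition wreath_one : wreath := (1%g, fs_one).

Definition wreath_inv (u : wreath) : wreath :=
  ((u.1)^-1%g, fs_shift (fs_inv u.2) (u.1)^-1%g).

Fact wreath_mulA : associative wreath_mul.
Proof.
move=> [a f] [b g] [c h]; rewrite /wreath_mul /= mulgA; congr pair.
by apply/fsfunP => x; rewrite !fsE invgM !mulgA.
Qed.

Fact wreath_mul1 : left_id wreath_one wreath_mul.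
Proof.
move=> [a f]; rewrite /wreath_mul /= mul1g; congr pair.
by apply/fsfunP => x; rewrite !fsE mul1g.
Qed.

Fact wreath_mulr1 : right_id wreath_one wreath_mul.
Proof.
move=> [a f]; rewrite /wreath_mul /= mulg1; congr pair.
by apply/fsfunP => x; rewrite !fsE invg1 !mulg1.
Qed.

Fact wreath_mulV : left_inverse wreath_one wreath_inv wreath_mul.
Proof.
move=> [a f]; rewrite /wreath_mul /wreath_inv /= mulVg; congr pair.
by apply/fsfunP => x; rewrite !fsE invgK mulgVK mulVg.
Qed.

Fact wreath_mulrV : right_inverse wreath_one wreath_inv wreath_mul.
Proof.
move=> [a f]; rewrite /wreath_mul /wreath_inv /= mulgV; congr pair.
by apply/fsfunP => x; rewrite !fsE mulgV.
Qed.

HB.instance Definition _ := isGroup.Build wreath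
  wreath_mulA wreath_mul1 wreath_mulr1 wreath_mulV wreath_mulrV.

End WreathProduct.

Definition Zgroup : groupType := Algebra.to_multiplicative int.

(* G 1 = Z and G i.+1 = Z wr G i for i >= 1; G 0 = Z is a dummy value. *)
Definition G (i : nat) : groupType :=
  iter i.-1 (fun H : groupType => wreath Zgroup H : groupType) Zgroup.

Lemma G_succ i : (1 <= i)%N -> G i.+1 = wreath Zgroup (G i).
Proof. by case: i. Qed.

Local Open Scope classical_set_scope.

Section RandomWalk.
Variables (R : realType) (H : groupType).
Implicit Types (S : {fset H}) (mu nu : H -> R) (g h : H) (n : nat).

Definition represents S (w : seq H) g : Prop :=
  all (fun s => (s \in S) || (s^-1%g \in S)) w /\ (\prod_(s <- w) s)%g = g.

Definition generating S : Prop := forall g, exists w : seq H, represents S w g.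

Definition symmetric S : Prop := forall s, s \in S -> s^-1%g \in S.

(* The length is 0 by convention on elements outside the subgroup generated
   by S. *)
Definition word_length S g : nat :=
  if pselect (exists n, `[< exists2 w : seq H, represents S w g & size w = n >])
    is left ex then ex_minn ex else 0%N.

Definition uniform_on S : H -> R :=
  fun g => if g \in S then (#|` S|%:R)^-1 else 0.

(* The sums over the group below are sums over the finite support of the
   summand; they are the actual sums as long as the measures involved have
   finite support, as all convolution powers of a finitely supported measure
   do. *)
Definition convolution mu nu : H -> R :=
  fun g => \sum_(h \in [set: H]) mu h * nu (h^-1 * g)%g.

Definition convolution_power mu n : H -> R :=
  iter n (convolution mu) (fun g => (g == 1%g)%:R).

Definition drift S mu n : R :=
  \sum_(g \in [set: H]) (word_length S g)%:R * convolution_power mu n g.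

Definition simple_random_walk mu : Prop :=
  exists S, [/\ symmetric S, generating S & mu = uniform_on S].

End RandomWalk.

Definition asymp (R : realType) (f g : nat -> R) : Prop :=
  exists c C : R, [/\ 0 < c, 0 < C &
    \forall n \near \oo, c * g n <= f n <= C * g n].

(* Main.v *)
From HB Require Import structures.
Require Import Defs.
From mathcomp Require Import all_boot all_order all_algebra finmap.
From mathcomp Require Import all_classical all_reals all_analysis.
From mathcomp Require Import ring lra zify.

(* Take as generators of Z wr A the two unit translations together with the
   generators of A placed at the origin.  Multiplying on the left, the walk
   moves a lamplighter on Z who, at each step, either moves to a neighbour or
   multiplies the lamp at the current position by a random generator of A.
   Conditionally on the trajectory, the lamp at x is a walk on A run for k_x
   steps, where k_x counts the switches at x, so up to constants the length of
   the walk has expectation E (range + sum_x k_x^alpha) when A has drift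
   n^alpha.  This is of order n^((1 + alpha)/2): with K of order sqrt n,
     K^alpha (k/K - (k/K)^2) <= k^alpha <= K^alpha (1_{k > 0} + k/K),
   so the bounds only require E range = O(sqrt n), E sum_x k_x >= c n and
   E sum_x k_x^2 = O(n^(3/2)).  The two O-estimates follow from one-step drift
   computations: the distance from the current position to the maximum (or
   minimum) of the trajectory has second moment at most n, and the range is the
   sum of these two distances; the self-intersection count sum_x k_x^2 is
   compensated by sum_x k_x |X - x|, since |X - x| is harmonic except at x.
   The exponents 1 - 2^-i are the orbit of 1/2 under
   alpha |-> (1 + alpha)/2. *)

Set Implicit Arguments.
Unset Strict Implicit.
Unset Printing Implicit Defensive.

Import Order.TTheory GRing.Theory Num.Theory.
Import numFieldNormedType.Exports.

Local Open Scope ring_scope.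

(** * Averages over words *)

Section Average.
Variable R : realType.

Fixpoint words (L : Type) (S : seq L) n : seq (seq L) :=
  if n is m.+1 then [seq s :: w | s <- S, w <- words S m] else [:: [::]].

(** Expectation of [phi] over [n] independent uniform letters of [S]. The head of a word is its
    latest letter, so products of words give the walk by left multiplication. *)
Definition avg (L : Type) (S : seq L) n (phi : seq L -> R) : R :=
  (\sum_(w <- words S n) phi w) / (size S)%:R ^+ n.

Lemma avg0 (L : Type) (S : seq L) phi : avg S 0 phi = phi [::].
Proof. by rewrite /avg /= big_seq1 expr0 divr1. Qed.

Lemma avgSl (L : Type) (S : seq L) n phi :
  avg S n.+1 phi =
  (\sum_(s <- S) avg S n (fun w => phi (s :: w))) / (size S)%:R.
Proof.
by rewrite /avg /= big_allpairs_dep -big_distrl /= -mulrA -invfM -exprSr.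
Qed.

Lemma avgZ (L : Type) (S : seq L) n c phi :
  avg S n (fun w => c * phi w) = c * avg S n phi.
Proof. by rewrite /avg -mulr_sumr mulrA. Qed.

Lemma avgD (L : Type) (S : seq L) n phi psi :
  avg S n (fun w => phi w + psi w) = avg S n phi + avg S n psi.
Proof. by rewrite /avg big_split mulrDl. Qed.

Lemma avgN (L : Type) (S : seq L) n phi :
  avg S n (fun w => - phi w) = - avg S n phi.
Proof. by rewrite /avg sumrN mulNr. Qed.

Lemma avg_sum (L I : Type) (S : seq L) n (r : seq I) (F : I -> seq L -> R) :
  avg S n (fun w => \sum_(i <- r) F i w) = \sum_(i <- r) avg S n (F i).
Proof. by rewrite /avg exchange_big /= mulr_suml. Qed.

Lemma eq_avg (L : Type) (S : seq L) n phi psi :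
  phi =1 psi -> avg S n phi = avg S n psi.
Proof. by move=> e; rewrite /avg; congr (_ / _); apply: eq_bigr => w _. Qed.

Lemma avgS (L : Type) (S : seq L) n phi :
  avg S n.+1 phi =
  avg S n (fun w => (\sum_(s <- S) phi (s :: w)) / (size S)%:R).
Proof.
rewrite avgSl -avg_sum /avg mulrAC -mulr_suml; congr (_ / _).
Qed.

Lemma size_words (L : eqType) (S : seq L) n w : w \in words S n -> size w = n.
Proof.
elim: n w => [|n IHn] w /=; first by rewrite inE => /eqP->.
by case/allpairsP => -[s v] /= [_ /IHn <- ->].
Qed.

Lemma le_avg (L : eqType) (S : seq L) n phi psi :
  (forall w, size w = n -> phi w <= psi w) -> avg S n phi <= avg S n psi.
Proof.
move=> le_phi; rewrite ler_wpM2r ?invr_ge0 ?exprn_ge0 ?ler0n //.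
by rewrite !big_seq; apply: ler_sum => w /size_words; apply: le_phi.
Qed.

Lemma avg_cst (L : Type) (S : seq L) n c : (0 < size S)%N ->
  avg S n (fun=> c) = c.
Proof.
move=> S0; elim: n => [|n IHn]; first by rewrite avg0.
rewrite avgSl IHn big_const_seq count_predT iter_addr addr0.
by rewrite -[X in X / _]mulr_natr mulfK // pnatr_eq0 -lt0n.
Qed.

Lemma avg_map (L L' : Type) (h : L -> L') (S : seq L) n phi :
  avg (map h S) n phi = avg S n (phi \o map h).
Proof.
elim: n phi => [|n IHn] phi; first by rewrite !avg0.
by rewrite !avgSl size_map big_map; congr (_ / _); apply: eq_bigr => s _.
Qed.

Lemma avg_perm (L : eqType) (S S' : seq L) n phi : perm_eq S S' ->
  avg S n phi = avg S' n phi.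
Proof.
move=> eqS; elim: n phi => [|n IHn] phi; first by rewrite !avg0.
rewrite !avgSl (perm_size eqS) (perm_big _ eqS); congr (_ / _).
by apply: eq_bigr => s _.
Qed.

Lemma avg_step_le (L : eqType) (S : seq L) (phi psi : seq L -> R) n :
    (forall w, (\sum_(s <- S) phi (s :: w)) / (size S)%:R <= phi w + psi w) ->
  avg S n.+1 phi <= avg S n phi + avg S n psi.
Proof. by move=> h; rewrite avgS -avgD; apply: le_avg. Qed.

(** Drift criterion: each new letter raises the conditional mean of [phi] by at most [c]. The moment
    estimates below reduce to such one-step checks. *)
Lemma avg_le_lin (L : eqType) (S : seq L) (phi : seq L -> R) c n :
    (0 < size S)%N -> phi [::] <= 0 ->
    (forall w, (\sum_(s <- S) phi (s :: w)) / (size S)%:R <= phi w + c) ->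
  avg S n phi <= c * n%:R.
Proof.
move=> S0 phi0 step; elim: n => [|n IHn]; first by rewrite avg0 mulr0.
rewrite -natr1 mulrDr mulr1.
apply: (le_trans (avg_step_le (psi := fun=> c) _ step)).
by rewrite avg_cst // lerD2r.
Qed.

(** The pointwise bound [phi <= phi^2 / (2c) + c / 2] replaces Cauchy-Schwarz. *)
Lemma avg_le_sqrt (L : eqType) (S : seq L) (phi : seq L -> R) n c :
    (0 < size S)%N -> 0 < c ->
  avg S n (fun w => phi w ^+ 2) <= c ^+ 2 -> avg S n phi <= c.
Proof.
move=> S0 c0 phi2.
apply: (@le_trans _ _ (avg S n (fun w => (2 * c)^-1 * phi w ^+ 2 + c / 2))).
  apply: le_avg => w _; rewrite -subr_ge0.
  have -> : (2 * c)^-1 * phi w ^+ 2 + c / 2 - phi w =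
    (2 * c)^-1 * (phi w - c) ^+ 2 by field; rewrite gt_eqF.
  by rewrite mulr_ge0 ?sqr_ge0 // invr_ge0 mulr_ge0 // ltW.
rewrite avgD avgZ avg_cst //.
apply: (@le_trans _ _ ((2 * c)^-1 * c ^+ 2 + c / 2)).
  by rewrite lerD2r ler_wpM2l // invr_ge0 mulr_ge0 // ltW.
by rewrite le_eqVlt; apply/orP; left; apply/eqP; field; rewrite gt_eqF.
Qed.

End Average.

(** * Word length and drift *)

Section WordLength.
Variable H : groupType.
Implicit Types (T : {fset H}) (g h : H).

Lemma represents1 T : represents T [::] 1%g.
Proof. by split => //; rewrite big_nil. Qed.

Lemma representsM T v w g h : represents T v g -> represents T w h ->
  represents T (v ++ w) (g * h)%g.
Proof.
by move=> [av <-] [aw <-]; split; rewrite ?all_cat ?av ?aw // big_cat.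
Qed.

Lemma word_length_le T w g : represents T w g -> (word_length T g <= size w)%N.
Proof.
move=> rw; rewrite /word_length; case: pselect => [ex|[]].
  by case: ex_minnP => m _; apply; apply/asboolP; exists w.
by exists (size w); apply/asboolP; exists w.
Qed.

Lemma word_lengthP T g : generating T ->
  exists2 w, represents T w g & size w = word_length T g.
Proof.
move=> /(_ g)[w rw]; rewrite /word_length; case: pselect => [ex|[]].
  by case: ex_minnP => m /asboolP.
by exists (size w); apply/asboolP; exists w.
Qed.

Lemma word_length1 T : word_length T 1%g = 0%N.
Proof. by apply/eqP; rewrite -leqn0 (word_length_le (represents1 T)). Qed.

Lemma word_lengthM T g h : generating T ->
  (word_length T (g * h)%g <= word_length T g + word_length T h)%N.
Proof.
move=> gT; have [v rv <-] := word_lengthP g gT.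
have [w rw <-] := word_lengthP h gT.
by rewrite -size_cat; apply/word_length_le/representsM.
Qed.

(** Reading a shortest word letter by letter, each letter costs at most the sum of [N] over all
    generators and their inverses. The constant depends on [N] and [T] only, so it serves a whole
    family of functions [f] at once. *)
Lemma word_length_dominates T (N : H -> nat) : generating T ->
  exists c, forall f : H -> nat, f 1%g = 0%N ->
    (forall s g, f (s * g)%g <= N s + f g)%N ->
    forall g, (f g <= c * word_length T g)%N.
Proof.
move=> gT; exists (\sum_(s <- T) (N s + N s^-1%g))%N => f f1 fM g.
have [w [aw <-] <-] := word_lengthP g gT.
elim: w aw => [|s w IHw] /=; first by rewrite big_nil f1.
case/andP => sT /IHw {}IHw; rewrite big_cons mulnS.
apply: leq_trans (fM _ _) (leq_add _ IHw).
case/orP: sT => sT; rewrite (big_fsetD1 _ sT) /=; first lia.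
by rewrite invgK; lia.
Qed.

End WordLength.

Section Drift.
Variables (R : realType) (H : groupType).
Implicit Types (S T : {fset H}) (g h : H).

Lemma convolution_power_uniform S n g :
  convolution_power (uniform_on R S) n g =
  avg S n (fun w => ((\prod_(s <- w) s)%g == g)%:R).
Proof.
elim: n g => [|n IHn] g; first by rewrite avg0 big_nil eq_sym.
rewrite [LHS]/convolution_power iterS -/(convolution_power _ _) /convolution.
rewrite (fsbigE S) /=; last 1 first.
- by move=> h _ hS; rewrite /uniform_on (negPf hS) mul0r.
- rewrite avgSl mulr_suml big_seq_cond [RHS]big_seq.
  apply: eq_big => [s|s]; first by rewrite in_setT andbT.
  case/andP => sS _; rewrite /uniform_on sS mulrC IHn; congr (_ * _).
  apply: eq_avg => w; rewrite big_cons; congr (_%:R).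
  by rewrite -(inj_eq (mulgI s)) mulVKg.
- exact: fset_uniq.
- by [].
Qed.

Lemma drift_avg S T n :
  drift T (uniform_on R S) n =
  avg S n (fun w => (word_length T (\prod_(s <- w) s)%g)%:R).
Proof.
(* The law at time [n] is carried by the finite set [F] of products of words of length [n]. *)
pose F := [fset (\prod_(s <- w) s)%g | w in words S n]%fset.
rewrite /drift (fsbigE F) /=; last 1 first.
- move=> g _ gF.
  rewrite convolution_power_uniform /avg big_seq big1 ?mul0r ?mulr0 //.
  move=> w wS; case: eqP => // e; case/negP: gF.
  by apply/imfsetP; exists w.
- rewrite /avg big_mkcond /=.
  under eq_bigr => g _ do
    rewrite in_setT convolution_power_uniform /avg mulrA mulr_sumr.
  rewrite -mulr_suml; congr (_ / _); rewrite exchange_big /= !big_seq.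
  apply: eq_bigr => w wS.
  have wF : (\prod_(s <- w) s)%g \in F by apply/imfsetP; exists w.
  rewrite (big_fsetD1 _ wF) /= eqxx mulr1.
 rewrite [X in (_ + X)%R]big1_seq ?addr0 // => g.
  by rewrite !inE eq_sym => /andP[_ /andP[/negPf -> _]]; rewrite mulr0.
- exact: fset_uniq.
- by [].
Qed.

End Drift.

(** * The lamplighter group *)

(** [LL] is kept abstract so that one argument yields both the existence of words (generation) and
    upper bounds on word length. *)
Lemma int_morphism_bound (H : groupType) (LL : H -> nat -> Prop)
    (h : int -> H) (c : nat) :
    {morph h : x y / x + y >-> (x * y)%g} -> LL 1%g 0%N ->
    (forall g g' m n, LL g m -> LL g' n -> LL (g * g')%g (m + n)%N) ->
    LL (h 1) c -> LL (h (-1)) c ->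
  forall x, LL (h x) (c * absz x)%N.
Proof.
move=> hD LL1 LLM LLp LLn.
have h0 : h 0 = 1%g by apply: (mulgI (h 0)); rewrite -hD addr0 mulg1.
suff key n : LL (h n%:Z) (c * n)%N /\ LL (h (- n%:Z)) (c * n)%N.
  by case=> n; rewrite ?NegzE ?abszN; case: (key n); case: (key n.+1).
elim: n => [|n [IHp IHn]]; first by rewrite muln0 oppr0 h0.
by rewrite mulnS -add1n PoszD opprD !hD; split; exact: LLM.
Qed.

Section Lamplighter.
Variable A : groupType.
Implicit Types (a : A) (x y : int).

Definition shift x : wreath Zgroup A := (x, fs_one Zgroup A).

Definition lamp a : wreath Zgroup A :=
  (1%g, [fsfun x in [fset 1%g]%fset => a | 1%g]).

Lemma wreath_eq (g h : wreath Zgroup A) :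
  g.1 = h.1 -> g.2 =1 h.2 -> g = h.
Proof. by case: g h => [x f] [y k] /= -> /fsfunP ->. Qed.

Lemma shiftM x (g : wreath Zgroup A) : (shift x * g)%g = (x + g.1, g.2).
Proof.
by congr pair; apply/fsfunP => y; rewrite fs_mulE fs_shiftE fs_oneE mul1g.
Qed.

Lemma lampM1 a (g : wreath Zgroup A) : (lamp a * g)%g.1 = g.1.
Proof. exact: mul1g. Qed.

(** The shift in the product carries the support of [lamp a] from the origin to [g.1]; this is why
    left multiplication switches the lamp at the current position. *)
Lemma lampM2 a (g : wreath Zgroup A) (x : Zgroup) :
  (lamp a * g)%g.2 x = if x == g.1 then (a * g.2 x)%g else g.2 x.
Proof.
rewrite /= fs_mulE fs_shiftE fsfunE inE.
have -> : ((x * g.1^-1)%g == 1%g) = (x == g.1).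
  by rewrite -(inj_eq (mulIg g.1)) mulgVK mul1g.
by case: eqP => // _; rewrite mul1g.
Qed.

Lemma shiftD x y : (shift x * shift y)%g = shift (x + y).
Proof. exact: shiftM. Qed.

Lemma lampD a b : (lamp a * lamp b)%g = lamp (a * b)%g.
Proof.
apply: wreath_eq => [|x]; first exact: lampM1.
rewrite lampM2 /lamp /= !fsfunE !inE; by case: eqP.
Qed.

Lemma shiftV x : (shift x)^-1%g = shift (- x).
Proof. by apply: (mulgI (shift x)); rewrite mulgV shiftD subrr. Qed.

Lemma lamp1 : lamp 1%g = 1%g.
Proof. by apply: (mulgI (lamp 1%g)); rewrite lampD !mulg1. Qed.

Lemma lampV a : (lamp a)^-1%g = lamp a^-1%g.
Proof. by apply: (mulgI (lamp a)); rewrite mulgV lampD mulgV lamp1. Qed.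

Lemma lamp_inj : injective lamp.
Proof.
move=> a b /(congr1 (fun g : wreath Zgroup A => g.2 (1%g : Zgroup))).
by rewrite /lamp /= !fsfunE !inE eqxx.
Qed.

Definition letter (s : bool + A) : wreath Zgroup A :=
  match s with inl b => shift ((-1) ^+ b) | inr a => lamp a end.

Lemma letter_inj : injective letter.
Proof.
move=> [b|a] [b'|a'] //=.
- by case=> e; congr inl; case: b b' e => -[].
- by case; case: b.
- by case; case: b'.
- by move/lamp_inj => ->.
Qed.

Definition alphabet (S : seq A) : seq (bool + A) :=
  inl false :: inl true :: map inr S.

Fixpoint pos (w : seq (bool + A)) : int :=
  match w with
  | inl b :: v => (-1) ^+ b + pos v
  | inr _ :: v => pos v
  | [::] => 0
  end.

(** Listed with multiplicity: [count_mem x (switches w)] is the number of switches made at [x]. *)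
Fixpoint switches (w : seq (bool + A)) : seq int :=
  match w with
  | inl _ :: v => switches v
  | inr _ :: v => pos v :: switches v
  | [::] => [::]
  end.

(* [lag false w] is the distance from the current position to the maximum of
   the trajectory, and [lag true w] the distance to its minimum. *)
Fixpoint lag (b : bool) (w : seq (bool + A)) : nat :=
  match w with
  | inl b' :: v => if b' == b then (lag b v).-1 else (lag b v).+1
  | inr _ :: v => lag b v
  | [::] => 0%N
  end.

Definition config (w : seq (bool + A)) : wreath Zgroup A :=
  (\prod_(s <- map letter w) s)%g.

Lemma config_cons s w : config (s :: w) = (letter s * config w)%g.
Proof. by rewrite /config /= big_cons. Qed.

Lemma config_pos w : (config w).1 = pos w.
Proof.
elim: w => [|s w IHw]; first by rewrite /config big_nil.
rewrite config_cons; case: s => [b|a] /=; first by rewrite -IHw.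
by rewrite -IHw; exact: mul1g.
Qed.

Lemma config_lamp s w (x : Zgroup) : (config (s :: w)).2 x =
  if s is inr a then if x == pos w then (a * (config w).2 x)%g
  else (config w).2 x else (config w).2 x.
Proof.
by rewrite config_cons -config_pos; case: s => [b|a]; rewrite ?lampM2 ?shiftM.
Qed.

Lemma config_switches w (x : Zgroup) : x \notin switches w ->
  (config w).2 x = 1%g.
Proof.
elim: w => [|s w IHw]; first by rewrite /config big_nil fs_oneE.
rewrite config_lamp; case: s => [b|a] //=; rewrite inE negb_or.
by case/andP => /negPf -> /IHw.
Qed.

Lemma pos_le w : `|pos w| <= (size w)%:Z.
Proof.
by elim: w => [//|[b|a] w IHw] /=; [case: b; rewrite ?expr0 ?expr1|]; lia.
Qed.

Lemma switches_le w y : y \in switches w -> `|y| <= (size w)%:Z.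
Proof.
elim: w => [//|[b|a] w IHw] /=; first by move/IHw; lia.
by rewrite inE => /orP[/eqP -> | /IHw]; [have := pos_le w|]; lia.
Qed.

(** The two bounds are the minimum and maximum of the trajectory: a move changes [pos] and [lag] so
    that they stay fixed, except when the predecessor truncates at 0, and then the interval grows by
    one. The starting point 0 is included for the cost of reaching the interval. *)
Lemma lag_window w y : y \in 0 :: switches w ->
  pos w - (lag true w)%:Z <= y <= pos w + (lag false w)%:Z.
Proof.
elim: w y => [|[b|a] w IHw] y /=; first by rewrite !inE => /eqP ->.
  by move/IHw; case: b; rewrite /= ?expr0 ?expr1; lia.
rewrite !inE orbCA => /orP[/eqP ->|y_in]; first lia.
by apply: IHw; rewrite inE.
Qed.

Lemma lag_le w : - (size w)%:Z <= pos w - (lag true w)%:Z /\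
  pos w + (lag false w)%:Z <= (size w)%:Z.
Proof.
elim: w => [//|[b|a] w [IHt IHf]] /=; last by split; lia.
by have := pos_le w; case: b; rewrite /= ?expr0 ?expr1; split; lia.
Qed.

(* [LL g n] stands for a bound of [n] on a length of [g].  The element [g] is
   reached by visiting the interval from [m] to [m + d], setting each lamp on
   the way, and then going to the final position. *)
Lemma wreath_bound (LL : wreath Zgroup A -> nat -> Prop) (c1 c2 : nat)
    (l : A -> nat) :
    (forall g h m n, LL g m -> LL h n -> LL (g * h)%g (m + n)%N) ->
    (forall x, LL (shift x) (c1 * absz x)%N) ->
    (forall a, LL (lamp a) (c2 * l a)%N) ->
  forall (m : int) d (g : wreath Zgroup A),
    (forall x : Zgroup, g.2 x != 1%g -> m <= x < m + d%:Z) ->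
  LL g (c1 * absz ((g.1 : int) - m - d%:Z)%R + (c1 * (d + absz m) +
        c2 * \sum_(i < d) l (g.2 (m + i%:Z : Zgroup)%R)))%N.
Proof.
move=> LLM LLs LLl m d g supp_g.
suff key : LL (m + d%:Z, g.2) (c1 * (d + absz m) +
    c2 * \sum_(i < d) l (g.2 (m + i%:Z : Zgroup)%R))%N.
  have := LLM _ _ _ _ (LLs ((g.1 : int) - m - d%:Z)) key.
  rewrite shiftM /= -[_ - d%:Z]addrA -opprD subrK.
  by case: g {supp_g key}.
elim: d (g.2) supp_g => [|d IHd] f supp_f.
  rewrite big_ord0 muln0 addn0 add0n addr0.
  have -> : f = fs_one Zgroup A.
    apply/fsfunP => x; rewrite fs_oneE; apply/eqP; apply: contraT => /supp_f.
    by rewrite addr0 => /andP[/le_lt_trans lt_m /lt_m]; rewrite ltxx.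
  exact: LLs.
(* The last lamp is peeled off: [h] stands at [m + d] with that lamp cleared, then [lamp a] sets it
   and [shift 1] moves on to [m + d + 1]. *)
pose a := f (m + d%:Z : Zgroup).
pose h : wreath Zgroup A := (lamp a^-1 * (m + d%:Z, f))%g.
have -> : (m + d.+1%:Z, f) = (shift 1 * (lamp a * h))%g :> wreath Zgroup A.
  by rewrite /h -lampV mulVKg shiftM /= -addn1 PoszD addrA addrC.
have h1 : h.1 = m + d%:Z by rewrite lampM1.
have h2 (x : Zgroup) : h.2 x = if x == m + d%:Z then 1%g else f x.
  by rewrite lampM2 /=; case: eqP => // ->; rewrite mulVg.
have -> : h = (m + d%:Z, h.2) by rewrite -h1; case: (h).
have supp_h (x : Zgroup) : h.2 x != 1%g -> m <= x < m + d%:Z.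
  have lt_d (z : int) : z <> m + d%:Z -> m <= z < m + d.+1%:Z ->
    m <= z < m + d%:Z by lia.
  rewrite h2; case: ifP => [_|/eqP ne_x]; first by rewrite eqxx.
  by move=> /supp_f; exact: lt_d.
have key := IHd h.2 supp_h.
have := LLM _ _ _ _ (LLs 1) (LLM _ _ _ _ (LLl a) key).
rewrite (eq_bigr (fun i : 'I_d => l (f (m + i%:Z : Zgroup)%R))); last first.
  by move=> i _; rewrite h2; case: eqP => // /addrI []; have := ltn_ord i; lia.
rewrite big_ord_recr /= -/a; set S := (\sum_(_ < _) _)%N; clearbody S.
by congr (LL _ _); rewrite /=; lia.
Qed.

End Lamplighter.

(** * Moment estimates for the trajectory *)

Section Moments.
Variables (R : realType) (A : groupType) (S : seq A).
Implicit Types (w : seq (bool + A)).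
Hypothesis S_gt0 : (0 < size S)%N.

Let r : R := (size S)%:R.
Local Notation alphabet := (alphabet S).
Local Notation E n phi := (avg alphabet n phi : R).

Let r_ge0 : 0 <= r. Proof. exact: ler0n. Qed.
Let r_gt0 : 0 < r. Proof. by rewrite ltr0n. Qed.

Lemma size_alphabet : (size alphabet)%:R = r + 2.
Proof. by rewrite /= size_map -addn2 natrD. Qed.

Lemma step_mean (phi : seq (bool + A) -> R) w :
  (\sum_(s <- alphabet) phi (s :: w)) / (size alphabet)%:R =
  (phi (inl false :: w) + phi (inl true :: w)
   + \sum_(a <- S) phi (inr a :: w)) / (r + 2).
Proof. by rewrite size_alphabet /alphabet !big_cons big_map addrA. Qed.

Lemma step_mean_cst (phi : seq (bool + A) -> R) w c :
    (forall a, phi (inr a :: w) = c) ->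
  (\sum_(s <- alphabet) phi (s :: w)) / (size alphabet)%:R =
  (phi (inl false :: w) + phi (inl true :: w) + r * c) / (r + 2).
Proof.
move=> phic; rewrite step_mean; under eq_bigr do rewrite phic.
by rewrite big_const_seq count_predT iter_addr addr0 [r * c]mulr_natl.
Qed.

(** The lag is a walk held at 0: for [k > 0] the squares of its two neighbours sum to [2k^2 + 2],
    and at 0 the truncation only lowers this. The mean gain per step is thus at most
    [2 / (r + 2)]. *)
Lemma avg_lag_sqr b n : E n (fun w => (lag b w)%:R ^+ 2) <= n%:R.
Proof.
rewrite -[leRHS]mul1r; apply: avg_le_lin => // [|w].
  by rewrite expr0n.
rewrite (@step_mean_cst (fun w => (lag b w)%:R ^+ 2) w ((lag b w)%:R ^+ 2)) //.
rewrite ler_pdivrMr; last first.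
  by rewrite ltr_wpDl.
suff: ((lag b w).-1%:R ^+ 2 + (lag b w).+1%:R ^+ 2
        <= 2 * (lag b w)%:R ^+ 2 + 2 :> R).
  move=> h; have r0 := r_ge0; rewrite /=.
  by case: (b) h => /= h; lra.
rewrite -!natrX -natrM -!natrD ler_nat; case: (lag b w) => //= k.
by rewrite -!mulnn; nia.
Qed.

Definition moment (f : int -> R) (w : seq (bool + A)) : R :=
  \sum_(y <- switches w) f (pos w - y).

(** A move contributes the discrete Laplacian of [f] at the displacement from each past switch; a
    switch adds one new point at displacement 0. *)
Lemma moment_step f w :
  (\sum_(s <- alphabet) moment f (s :: w)) / (size alphabet)%:R =
  moment f w +
  (moment (fun z => f (1 + z) + f (-1 + z) - 2 * f z) w + r * f 0) / (r + 2).
Proof.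
rewrite (@step_mean_cst (moment f) w (f 0 + moment f w)); last first.
  by move=> a; rewrite /moment /= big_cons subrr.
rewrite /moment /= !big_split /= sumrN -mulr_sumr.
under eq_bigr do rewrite -addrA.
under [X in _ + X + _]eq_bigr do rewrite -addrA.
by field; rewrite gt_eqF // ltr_wpDl.
Qed.

(** Grouped by sites, this is the sum of the squares of the occupation numbers. *)
Definition collisions (w : seq (bool + A)) : R :=
  \sum_(y <- switches w) (count_mem y (switches w))%:R.

Lemma momentE w :
  (count_mem (pos w) (switches w))%:R = moment (fun z => (z == 0)%:R) w.
Proof.
rewrite -sum1_count natr_sum big_mkcond /=; apply: eq_bigr => y _.
by rewrite subr_eq0 eq_sym; case: eqP.
Qed.

(** This is [(k + 1)^2 = k^2 + 2k + 1] at the current site, where the moment of the indicator of 0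
    is [k]. *)
Lemma collisions_switch a w : collisions (inr a :: w) =
  collisions w + 2 * moment (fun z => (z == 0)%:R) w + 1.
Proof.
rewrite /collisions /= big_cons eqxx natrD momentE /=.
under eq_bigr do rewrite natrD.
rewrite big_split /= -/(collisions w).
rewrite (_ : \sum_(y <- _) _ = moment (fun z => (z == 0)%:R) w); first by ring.
by apply: eq_bigr => y _; rewrite subr_eq0.
Qed.

(* [|z|] is harmonic except at [0], where its Laplacian cancels the growth of
   the collisions. *)
Lemma avg_collisions_le n :
  E n (fun w => collisions w - r * moment (fun z => `|z|%:~R) w) <= n%:R.
Proof.
rewrite -[leRHS]mul1r; apply: avg_le_lin => // [|w].
  by rewrite /collisions /moment /= !big_nil mulr0 subrr.
rewrite big_split /= sumrN -mulr_sumr mulrBl -mulrA moment_step.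
rewrite (@step_mean_cst collisions w _ (collisions_switch^~ w)).
rewrite -[collisions (_ :: _)]/(collisions w).
rewrite -[collisions (_ true :: _)]/(collisions w).
rewrite (_ : moment (fun z => _ - _) w = 2 * moment (fun z => (z == 0)%:R) w).
  set m := moment _ w; set d := moment _ w; set q := collisions w.
  rewrite normr0 mulr0z mulr0 addr0 -subr_ge0.
  rewrite (_ : _ - _ = 2 / (r + 2)); last by field; rewrite gt_eqF // ltr_wpDl.
  by rewrite divr_ge0 // addr_ge0.
rewrite /moment mulr_sumr; apply: eq_bigr => y _; set z := pos w - y.
have /(congr1 (fun k : int => k%:~R : R)) :
  `|1 + z| + `|-1 + z| - 2 * `|z| = 2 * (z == 0)%:Z by lia.
by rewrite intrB intrD !intrM.
Qed.

Lemma size_switches w : (size (switches w))%:R = moment (fun=> 1) w.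
Proof. by rewrite /moment big_const_seq count_predT iter_addr addr0. Qed.

(** Each letter is a switch with probability [r / (r + 2)]; negation turns the upper drift criterion
    into a lower bound. *)
Lemma avg_size_switches n :
  r / (r + 2) * n%:R <= E n (fun w => (size (switches w))%:R).
Proof.
rewrite -lerN2 -avgN -mulNr; apply: avg_le_lin => // w.
under eq_bigr do rewrite size_switches.
rewrite sumrN mulNr moment_step -size_switches opprD lerD2l lerN2.
rewrite ler_pM2r ?invr_gt0 ?ltr_wpDl // [r * 1]mulr1 lerDr.
by rewrite /moment big1 // => y _; lra.
Qed.

Lemma size_switches_le w : (size (switches w) <= size w)%N.
Proof. by elim: w => [|[b|a] w IHw] //=; exact: leqW. Qed.

(** The Laplacian of [z^2] is the constant 2, so the mean gain per step is at most the number of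
    switches so far, hence at most [n]. *)
Lemma avg_moment_sqr n : E n (moment (fun z => z%:~R ^+ 2)) <= n%:R ^+ 2.
Proof.
elim: n => [|n IHn]; first by rewrite avg0 /moment big_nil sqr_ge0.
have step w : (\sum_(s <- alphabet) moment (fun z => z%:~R ^+ 2) (s :: w))
    / (size alphabet)%:R <=
    moment (fun z => z%:~R ^+ 2) w + (size (switches w))%:R.
  rewrite moment_step lerD2l ler_pdivrMr ?ltr_wpDl //.
  rewrite expr0n mulr0 addr0.
  rewrite (_ : moment _ w = 2 * (size (switches w))%:R).
    by rewrite mulrC ler_wpM2l // lerDr.
  rewrite size_switches /moment mulr_sumr; apply: eq_bigr => y _.
  by rewrite !intrD; ring.
apply: le_trans (avg_step_le _ step) _.
apply: (@le_trans _ _ (n%:R ^+ 2 + n%:R)).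
  rewrite lerD // -[leRHS](@avg_cst R _ alphabet n) //; apply: le_avg => w sw.
  by rewrite ler_nat -sw size_switches_le.
by rewrite -natrX -natrD -natrX ler_nat -!mulnn; nia.
Qed.

(** By [avg_collisions_le] it remains to bound the mean of the sum of [|z|] by [c^3]. This follows
    from [|z| <= z^2 / (2c) + c / 2], the second moment bound [n^2 = c^4] and the bound [n = c^2] on
    the number of switches. *)
Lemma avg_collisions n c : 1 <= c -> n%:R = c ^+ 2 ->
  E n collisions <= (r + 1) * c ^+ 3.
Proof.
move=> c1 nc; have c0 : 0 < c by apply: lt_le_trans c1.
pose V := moment (fun z => `|z|%:~R).
have := avg_collisions_le n; rewrite avgD avgN avgZ -/V => leQ.
suff leV : E n V <= c ^+ 3.
  have : r * E n V <= r * c ^+ 3 by rewrite ler_wpM2l.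
  have : c ^+ 2 <= c ^+ 3 by rewrite (exprS c 2) ler_peMl ?sqr_ge0.
  by rewrite mulrDl mul1r; lra.
apply: (@le_trans _ _ (E n (fun w => (2 * c)^-1 *
    moment (fun z => z%:~R ^+ 2) w + c / 2 * (size (switches w))%:R))).
  apply: le_avg => w _.
  rewrite size_switches /V /moment !mulr_sumr -big_split /=.
  apply: ler_sum => y _; set z := pos w - y.
  rewrite -(real_normK (num_real (z%:~R : R))) -intr_norm mulr1 -subr_ge0.
  set u := `|z|%:~R; rewrite (_ : _ - u = (2 * c)^-1 * (u - c) ^+ 2).
    by rewrite mulr_ge0 ?sqr_ge0 // invr_ge0 mulr_ge0 // ltW.
  by field; rewrite gt_eqF.
rewrite avgD !avgZ.
apply: (@le_trans _ _ ((2 * c)^-1 * (c ^+ 2) ^+ 2 + c / 2 * c ^+ 2)).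
  rewrite lerD // ler_wpM2l ?invr_ge0 ?divr_ge0 ?mulr_ge0 ?(ltW c0) //.
    by rewrite -nc avg_moment_sqr.
  rewrite -nc -[leRHS](@avg_cst R _ alphabet n) //; apply: le_avg => w sw.
  by rewrite ler_nat -sw size_switches_le.
by rewrite le_eqVlt; apply/orP; left; apply/eqP; field; rewrite gt_eqF.
Qed.

End Moments.

(** * Occupation profile *)

(** With [u = k / K], the power [u^alpha] is at most 1 when [0 < u <= 1] and at most [u] when
    [u >= 1]; at [k = 0] both sides vanish. *)
Lemma powR_upper (R : realType) (alpha K k : R) : 0 < alpha < 1 -> 0 < K ->
  0 <= k -> k `^ alpha <= K `^ alpha * ((k != 0)%:R + k / K).
Proof.
case/andP=> a0 a1 K0; rewrite le_eqVlt eq_sym => /predU1P[->|k0].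
  by rewrite eqxx mul0r addr0 mulr0 powR0 // gt_eqF.
have u0 : 0 < k / K by rewrite divr_gt0.
rewrite gt_eqF // -{1}(divfK (lt0r_neq0 K0) k) powRM ?(ltW u0) ?(ltW K0) //.
rewrite mulrC ler_wpM2l ?powR_ge0 //=.
have [u1|u1] := leP (k / K) 1.
  rewrite ler_wpDr ?(ltW u0) // -(powRr0 (k / K)).
  by apply: ger_powR; rewrite ?u0 ?u1 ?(ltW a0).
by rewrite ler_wpDl // ler1_powR // ltW.
Qed.

(** With [u = k / K]: if [u <= 1] then [u - u^2 <= u <= u^alpha], and if [u > 1] the left side is at
    most 0. *)
Lemma powR_lower (R : realType) (alpha K k : R) : 0 < alpha < 1 -> 0 < K ->
  0 <= k -> K `^ alpha * (k / K - (k / K) ^+ 2) <= k `^ alpha.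
Proof.
case/andP=> a0 a1 K0; rewrite le_eqVlt eq_sym => /predU1P[->|k0].
  by rewrite mul0r expr0n subrr mulr0 powR_ge0.
have u0 : 0 < k / K by rewrite divr_gt0.
rewrite -{3}(divfK (lt0r_neq0 K0) k) powRM ?(ltW u0) ?(ltW K0) //.
rewrite mulrC ler_wpM2r ?powR_ge0 //.
have [u1|u1] := leP (k / K) 1.
  apply: (@le_trans _ _ (k / K)); first by rewrite gerBl sqr_ge0.
  by rewrite ger1_powR ?u0 ?u1 // ltW.
apply: le_trans (powR_ge0 _ _).
by rewrite subr_le0 expr2 ler_peMr // ltW.
Qed.

Definition interval_seq (m : int) (d : nat) : seq int :=
  [seq m + i%:Z | i <- iota 0 d].

Lemma mem_interval_seq m d y : (y \in interval_seq m d) = (m <= y < m + d%:Z).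
Proof.
apply/mapP/idP => [[i] | /andP[le_m lt_d]].
  by rewrite mem_iota => ? ->; lia.
by exists (absz (y - m)); [rewrite mem_iota|]; lia.
Qed.

Lemma interval_seq_uniq m d : uniq (interval_seq m d).
Proof. by rewrite map_inj_uniq ?iota_uniq // => i j /addrI []. Qed.

(** Contains every site reachable in [n] steps, so sums over sites range over a list independent of
    the word and commute with [avg]. *)
Definition window n := interval_seq (- n%:Z) n.*2.+1.

Lemma mem_window n y : (y \in window n) = (`|y| <= n%:Z).
Proof. by rewrite mem_interval_seq; lia. Qed.

Lemma sum_count_mem (R : pzSemiRingType) (I : eqType) (r s : seq I)
    (F : I -> R) :
    uniq r -> {subset s <= r} ->
  \sum_(x <- r) (count_mem x s)%:R * F x = \sum_(y <- s) F y.
Proof.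
move=> ur; elim: s => [|y s IHs] sub_s.
  by rewrite big_nil big1 // => x _; rewrite mul0r.
rewrite big_cons -IHs; last by move=> z zs; apply: sub_s; rewrite inE zs orbT.
under eq_bigr do rewrite /= natrD mulrDl.
rewrite big_split /= (bigD1_seq y) ?sub_s ?mem_head //= eqxx mul1r.
by rewrite big1 ?addr0 // => x; rewrite eq_sym => /negPf ->; rewrite mul0r.
Qed.

Section Occupation.
Variables (R : realType) (A : groupType) (S : seq A).
Hypothesis S_gt0 : (0 < size S)%N.
Implicit Types (w : seq (bool + A)).

Local Notation r := ((size S)%:R : R).
Local Notation E n phi := (avg (alphabet S) n phi : R).

Lemma switches_window n w : size w = n -> {subset switches w <= window n}.
Proof. by move=> <- y; rewrite mem_window => /switches_le. Qed.

(* Given the trajectory, the lamp at [x] is a random walk on [A] run for as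
   many steps as there were switches at [x]. *)
Lemma avg_config n x (phi : int -> A -> R) :
  E n (fun w => phi (pos w) ((config w).2 (x : Zgroup))) =
  E n (fun w => avg S (count_mem x (switches w))
                  (fun v => phi (pos w) (\prod_(a <- v) a)%g)).
Proof.
elim: n phi => [|n IHn] phi.
  by rewrite !avg0 /config /= !big_nil fs_oneE.
rewrite !avgS.
(* [phi'] averages [phi] over the next letter. Whether that letter acts on the lamp at [x] depends
   on the position, which is why [phi] takes the position as an argument too. *)
pose phi' p a := (phi (1 + p) a + phi (-1 + p) a +
  \sum_(b <- S) phi p (if x == p then (b * a)%g else a)) / (r + 2).
transitivity (E n (fun w => phi' (pos w) ((config w).2 (x : Zgroup)))).
  apply: eq_avg => w.
  rewrite (@step_mean _ _ _ (fun w => phi (pos w) ((config w).2 (x : Zgroup)))).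
  rewrite !config_lamp /phi' /=; congr ((_ + _) / _); apply: eq_bigr => a _.
  by rewrite config_lamp; case: ifP.
rewrite IHn; apply: eq_avg => w.
rewrite (@step_mean _ _ _ (fun w => avg S (count_mem x (switches w))
                  (fun v => phi (pos w) (\prod_(a <- v) a)%g))) /=.
rewrite /phi'; set k := count_mem x (switches w).
under eq_avg do rewrite mulrC.
rewrite avgZ mulrC !avgD avg_sum; congr ((_ + _) / _).
rewrite [in RHS]big_const_seq count_predT iter_addr addr0 -[RHS]mulr_natl.
(* At [x] itself, the switch is one more letter of the walk on [A]; elsewhere the lamp does not
   change. *)
rewrite eq_sym; case: eqP => _ /=.
  rewrite add1n avgSl mulrC divfK ?pnatr_eq0 -?lt0n //.
  by apply: eq_bigr => a _; apply: eq_avg => v; rewrite big_cons.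
by rewrite big_const_seq count_predT iter_addr addr0 -[LHS]mulr_natl add0n.
Qed.

(** Switched sites lie between the minimum and the maximum of the trajectory, an interval with this
    many points. *)
Lemma sum_occupied n w : size w = n ->
  \sum_(x <- window n) ((count_mem x (switches w) != 0%N)%:R : R) <=
  (lag true w)%:R + (lag false w)%:R + 1.
Proof.
move=> sw; rewrite -natr_sum -natrD natr1 ler_nat.
rewrite (eq_bigr (fun x => if x \in switches w then 1 else 0)%N); last first.
  by move=> x _; rewrite -lt0n -has_count has_pred1; case: (_ \in _).
rewrite -big_mkcond sum1_count -size_filter.
set d := (lag true w + lag false w)%N.+1.
pose I := interval_seq (pos w - (lag true w)%:Z) d.
have <- : size I = d by rewrite size_map size_iota.
apply: uniq_leq_size => [|y]; first exact/filter_uniq/interval_seq_uniq.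
rewrite mem_filter => /andP[yw _]; rewrite mem_interval_seq.
have := @lag_window _ w y; rewrite inE yw orbT => /(_ isT).
by lia.
Qed.

Section Profile.
Variables (alpha : R) (n : nat) (s : R).
Hypothesis (alpha01 : 0 < alpha < 1) (s_ge1 : 1 <= s) (n_sqr : n%:R = s ^+ 2).
Let s_gt0 : 0 < s. Proof. exact: lt_le_trans s_ge1. Qed.

Lemma avg_lag b : E n (fun w => (lag b w)%:R) <= s.
Proof.
apply: avg_le_sqrt => //.
by rewrite -n_sqr; apply: avg_lag_sqr.
Qed.

Lemma avg_profile_upper :
  E n (fun w => \sum_(x <- window n) (count_mem x (switches w))%:R `^ alpha)
  <= 4 * (s `^ alpha * s).
Proof.
(* [powR_upper] is used with [K = s]: the occupied sites contribute at most [2s + 1] on average and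
   the sum of [k / s] at most [n / s = s], in total at most [4s]. *)
apply: (@le_trans _ _ (E n (fun w => s `^ alpha *
  ((lag true w)%:R + (lag false w)%:R + (1 + s))))).
  apply: le_avg => w sw.
  apply: (@le_trans _ _ (\sum_(x <- window n) s `^ alpha *
    (((count_mem x (switches w))%:R != 0 :> R)%:R
     + (count_mem x (switches w))%:R / s))).
    by apply: ler_sum => x _; apply: powR_upper.
  rewrite -mulr_sumr ler_wpM2l ?powR_ge0 // addrA big_split /= lerD //.
    apply: le_trans (sum_occupied sw); apply: ler_sum => x _.
    by rewrite pnatr_eq0.
  rewrite (sum_count_mem (fun=> s^-1)); first last.
  - exact: switches_window.
  - exact: interval_seq_uniq.
  rewrite big_const_seq count_predT iter_addr addr0 -[leLHS]mulr_natl.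
  by rewrite ler_pdivrMr // -expr2 -n_sqr -sw ler_nat size_switches_le.
rewrite avgZ !avgD !avg_cst // mulrCA ler_wpM2l ?powR_ge0 //.
by have := avg_lag true; have := avg_lag false; have := s_ge1; lra.
Qed.

Lemma avg_profile_lower (p := r / (r + 2)) (B := 2 * (r + 1) / p) :
  B `^ alpha * (p / (2 * B)) * (s `^ alpha * s) <=
  E n (fun w => \sum_(x <- window n) (count_mem x (switches w))%:R `^ alpha).
Proof.
have r_gt0 : 0 < r by rewrite ltr0n.
have p_gt0 : 0 < p by rewrite divr_gt0 // addr_gt0.
have B_gt0 : 0 < B by rewrite divr_gt0 // mulr_gt0 // addr_gt0.
(* [B] is chosen so that the quadratic term costs half of the linear one: the means are at least
   [p s / B] and at most [(r + 1) s / B^2 = p s / (2B)]. *)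
pose K := B * s; have K_gt0 : 0 < K by rewrite mulr_gt0.
have Ka : K `^ alpha = B `^ alpha * s `^ alpha by rewrite powRM // ltW.
have rB : r + 1 = p * B / 2 by rewrite /B; field; rewrite gt_eqF.
apply: (@le_trans _ _ (E n (fun w => K `^ alpha *
    (K^-1 * (size (switches w))%:R - K^-2 * collisions R w)))).
  rewrite avgZ avgD avgN !avgZ.
  rewrite (_ : _ * _ = K `^ alpha * (K^-1 * (p * n%:R)
    - K^-2 * ((r + 1) * s ^+ 3))); last first.
    rewrite n_sqr Ka rB /K; move: (B) (p) B_gt0 => b q b_gt0; field.
    by rewrite !gt_eqF.
  rewrite ler_wpM2l ?powR_ge0 // lerB // ler_wpM2l ?invr_ge0 ?(ltW K_gt0) //.
  - exact: avg_size_switches.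
  - by rewrite exprn_ge0 // ltW.
  - exact: avg_collisions.
apply: le_avg => w sw.
have uW := interval_seq_uniq (- n%:Z) n.*2.+1.
have sub_w := switches_window sw.
have -> : (size (switches w))%:R =
    \sum_(x <- window n) ((count_mem x (switches w))%:R : R) * 1.
  by rewrite sum_count_mem // big_const_seq count_predT iter_addr addr0.
rewrite /collisions -(sum_count_mem (R := R) _ uW sub_w) !mulr_sumr.
rewrite -sumrN -big_split /=.
rewrite mulr_sumr; apply: ler_sum => x _.
apply: le_trans (powR_lower alpha01 K_gt0 _) => //.
by rewrite le_eqVlt; apply/orP; left; apply/eqP; field; rewrite gt_eqF.
Qed.
End Profile.

End Occupation.

(** * Word length in the wreath product *)

Section Generators.
Variables (A : groupType) (S : {fset A}).

Definition wreath_generators : {fset wreath Zgroup A} :=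
  [fset g in map (@letter A) (alphabet S)]%fset.

Lemma mem_wreath_generators s : s \in alphabet S ->
  letter s \in wreath_generators.
Proof. by move=> sS; rewrite in_fset; apply: map_f. Qed.

Lemma alphabet_uniq : uniq (alphabet S).
Proof.
rewrite /= !inE map_inj_uniq ?fset_uniq ?andbT; last by move=> a b [].
by apply/andP; split; apply/negP => /mapP[].
Qed.

Lemma perm_wreath_generators :
  perm_eq wreath_generators (map (@letter A) (alphabet S)).
Proof.
apply: uniq_perm; first exact: fset_uniq.
  by rewrite (map_inj_uniq (@letter_inj A)) alphabet_uniq.
by move=> g; rewrite in_fset.
Qed.

Lemma wreath_generators_symmetric :
  Defs.symmetric S -> Defs.symmetric wreath_generators.
Proof.
move=> symS g; rewrite in_fset => /mapP[[b|a] sS ->] /=.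
  rewrite shiftV -[X in shift _ X]/(- ((-1) ^+ b)) -signrN -/(letter (inl _)).
  by apply: (mem_wreath_generators (s := inl _)); rewrite !inE; case: (b).
rewrite lampV; apply: (mem_wreath_generators (s := inr _)).
move: sS; rewrite !inE /= !mem_map; first exact: symS.
all: by move=> ? ? [].
Qed.

Lemma wreath_generators_generating : generating S ->
  generating wreath_generators.
Proof.
move=> genS g; set T := wreath_generators.
(* With [LL] read as mere existence of a word, [wreath_bound] becomes a statement of generation. *)
pose LL (h : wreath Zgroup A) (n : nat) := exists w, represents T w h.
have LL1 : LL 1%g 0%N by exists [::]; exact: represents1.
have LLM h h' m n : LL h m -> LL h' n -> LL (h * h')%g (m + n)%N.
  by move=> [v rv] [w rw]; exists (v ++ w); exact: representsM.
have LLletter s n : s \in alphabet S -> LL (letter s) n.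
  move=> sS; exists [:: letter s]; split; last by rewrite big_seq1.
  by rewrite /= mem_wreath_generators.
have LLs x : LL (shift A x) (0 * absz x)%N.
  apply: (int_morphism_bound (c := 0%N)) => //.
  - by move=> y z; rewrite shiftD.
  - by apply: (LLletter (inl false) 0%N); rewrite !inE.
  - by apply: (LLletter (inl true) 0%N); rewrite !inE.
have LLl a : LL (lamp a) (0 * 0)%N.
  have [w [aw <-]] := genS a; elim: w aw => [|b w IHw] /=.
    by rewrite big_nil lamp1.
  case/andP=> bS /IHw LLw; rewrite big_cons -lampD.
  apply: (LLM _ _ 0%N 0%N) LLw.
  exists [:: lamp b]; split; last by rewrite big_seq1.
  rewrite /= andbT lampV; apply/orP; case/orP: bS => bS; [left|right];
    apply: (mem_wreath_generators (s := inr _));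
    by rewrite !inE /= mem_map // => ? ? [].
pose M := (\sum_(x <- finsupp g.2) absz (x : int))%N.
have supp_g (x : Zgroup) : g.2 x != 1%g ->
    - M%:Z <= (x : int) < - M%:Z + (M.*2.+1)%:Z.
  rewrite -mem_finsupp => xg.
  have : (absz (x : int) <= M)%N by rewrite /M (big_fsetD1 _ xg) /= leq_addr.
  by set y : int := x; lia.
have [w rw] := wreath_bound (l := fun=> 0%N) LLM LLs LLl supp_g.
by exists w.
Qed.

End Generators.

(** The induction invariant. The bounds hold for every [n], not just eventually, because the next
    level applies them at the random times [k_x], which may be small or zero. *)
Definition drift_growth (R : realType) (A : groupType) (alpha : R) : Prop :=
  exists S : {fset A}, [/\ Defs.symmetric S, generating S, (0 < size S)%N &
    forall T : {fset A}, generating T ->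
      exists c C : R, [/\ 0 < c, 0 < C & forall n,
        c * n%:R `^ alpha <= drift T (uniform_on R S) n <= C * n%:R `^ alpha]].

Section WreathStep.
Variables (R : realType) (A : groupType) (S : {fset A}).
Hypothesis genS : generating S.
Implicit Types (T : {fset wreath Zgroup A}) (w : seq (bool + A)).

Local Notation E n phi := (avg (alphabet S) n phi : R).
Local Notation l := (word_length S).

Lemma wreath_drift T n : drift T (uniform_on R (wreath_generators S)) n =
  E n (fun w => (word_length T (config w))%:R).
Proof.
by rewrite drift_avg (avg_perm _ _ (perm_wreath_generators S)) avg_map.
Qed.

Lemma wreath_length_upper T : generating T ->
  exists c1 c2 : nat, forall w n, size w = n ->
    (word_length T (config w) <= c1 * (lag true w + lag false w).+1
      + c2 * \sum_(x <- window n) l ((config w).2 (x : Zgroup)))%N.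
Proof.
move=> genT; pose LL (h : wreath Zgroup A) n := (word_length T h <= n)%N.
have LLM h h' m n : LL h m -> LL h' n -> LL (h * h')%g (m + n)%N.
  by move=> hm hn; apply: leq_trans (word_lengthM _ _ genT) (leq_add hm hn).
pose c1 := (word_length T (shift A 1) + word_length T (shift A (-1)))%N.
have LLs x : LL (shift A x) (c1 * absz x)%N.
  apply: (int_morphism_bound (LL := LL) (c := c1)) => //.
  - by move=> y z; rewrite shiftD.
  - by rewrite /LL word_length1.
  - by rewrite /LL leq_addr.
  - by rewrite /LL leq_addl.
have [c2 dom] := word_length_dominates (fun a => word_length T (lamp a)) genS.
have LLl a : LL (lamp a) (c2 * l a)%N.
  refine (dom (fun a => word_length T (lamp a)) _ _ a) => [|s g].
    by rewrite lamp1 word_length1.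
  by rewrite -lampD word_lengthM.
(* The factor 3 pays for going to the left end of the interval, sweeping it and moving to the final
   position, each of length at most [d]. *)
exists (3 * c1)%N, c2 => w n sw; set d := (_ + _).+1.
pose m := pos w - (lag true w)%:Z.
have supp_w (x : Zgroup) : (config w).2 x != 1%g -> m <= x < m + d%:Z.
  move=> xw; have : (x : int) \in 0 :: switches w.
    rewrite inE; apply/orP; right; apply: contraNT xw => /config_switches ->.
    exact: eqxx.
  move/lag_window.
  by rewrite /m /d; set y : int := x; lia.
apply: leq_trans (wreath_bound (LL := LL) LLM LLs LLl supp_w) _.
rewrite addnA leq_add //.
  rewrite config_pos -mulnDr -mulnA mulnCA leq_mul2l; apply/orP; right.
  have := @lag_window _ w 0 (mem_head _ _).
  by rewrite /m /d; lia.
rewrite leq_mul2l; apply/orP; right.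
have -> : (\sum_(i < d) l ((config w).2 (m + i%:Z : Zgroup)%R) =
    \sum_(x <- interval_seq m d) l ((config w).2 (x : Zgroup)))%N.
  rewrite big_map.
  rewrite -(big_mkord xpredT (fun i => l ((config w).2 (m + i%:Z : Zgroup)%R))).
  by rewrite /index_iota subn0.
apply: (uniq_sub_le_big (le := leq)) => //.
- by move=> i j; exact: leq_addr.
- exact: interval_seq_uniq.
- exact: interval_seq_uniq.
- move=> y; rewrite mem_interval_seq mem_window -sw.
  by have := lag_le w; rewrite /m /d; lia.
Qed.

(** Left multiplication by [s] raises the total length of the lamps by at most that of the lamps of
    [s], whatever the window; the uniformity in [word_length_dominates] makes [c] independent of
    [n]. *)
Lemma wreath_length_lower T : generating T ->
  exists c : nat, forall n (g : wreath Zgroup A),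
    (\sum_(x <- window n) l (g.2 (x : Zgroup)) <= c * word_length T g)%N.
Proof.
move=> genT.
pose N (g : wreath Zgroup A) := (\sum_(y <- finsupp g.2) l (g.2 y))%N.
have [c dom] := word_length_dominates N genT.
exists c => n; apply: dom => [|s g].
  by rewrite big1 // => x _; rewrite fs_oneE word_length1.
rewrite [leqRHS]addnC.
apply: (@leq_trans (\sum_(x <- window n)
    (l (g.2 (x : Zgroup)) + l (s.2 ((x : Zgroup) * g.1^-1)%g)))%N).
  apply: leq_sum => x _; rewrite /= fs_mulE fs_shiftE addnC.
  exact: word_lengthM.
rewrite big_split leq_add2l /N /=.
(* Each lamp [y] of [s] lands on the single site [y * g.1], so it is counted at most once in the
   window. *)
apply: (@leq_trans (\sum_(x <- window n) \sum_(y <- finsupp s.2)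
    (if ((x : Zgroup) == y * g.1)%g then l (s.2 y) else 0))%N).
  apply: leq_sum => x _; set z := (_ * _)%g.
  case: (finsuppP s.2 z) => [_|zs]; first by rewrite word_length1.
  by rewrite (big_fsetD1 _ zs) /= mulgVK eqxx leq_addr.
rewrite exchange_big /=; apply: leq_sum => y _.
rewrite -big_mkcond /= big_const_seq iter_addn_0 -[leqRHS]muln1 leq_mul2l.
have /(count_uniq_mem ((y * g.1)%g : int)) :=
  interval_seq_uniq (- n%:Z) n.*2.+1.
by move=> countE; rewrite [count _ _]countE leq_b1 orbT.
Qed.

End WreathStep.

(** * Growth of the drift *)

Lemma powR_half (R : realType) (alpha x : R) : 0 < x ->
  x `^ ((1 + alpha) / 2) = Num.sqrt x `^ alpha * Num.sqrt x.
Proof.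
move=> x0; have s0 : 0 < Num.sqrt x by rewrite sqrtr_gt0.
rewrite mulrC powRrM powR12_sqrt ?(ltW x0) // addrC powRD ?powRr1 ?(ltW s0) //.
by rewrite (gt_eqF s0) implybT.
Qed.

Section WreathGrowth.
Variables (R : realType) (A : groupType) (S : {fset A}) (alpha c C : R).
Hypotheses (alpha01 : 0 < alpha < 1) (genS : generating S).
Hypotheses (S_gt0 : (0 < size S)%N) (c_gt0 : 0 < c) (C_gt0 : 0 < C).
Hypothesis growthS : forall n,
  c * n%:R `^ alpha <= drift S (uniform_on R S) n <= C * n%:R `^ alpha.

Local Notation E n phi := (avg (alphabet S) n phi : R).
Local Notation l := (word_length S).
Local Notation lamps n w :=
  (\sum_(x <- window n) l ((config w).2 (x : Zgroup)))%N.

Lemma avg_lamps n : E n (fun w => (lamps n w)%:R) =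
  E n (fun w => \sum_(x <- window n)
    drift S (uniform_on R S) (count_mem x (switches w))).
Proof.
under eq_avg do rewrite natr_sum.
rewrite !avg_sum; apply: eq_bigr => x _.
rewrite (avg_config S_gt0 n x (fun _ a => (l a)%:R)).
by apply: eq_avg => w; rewrite drift_avg.
Qed.

Lemma wreath_drift_growth (T : {fset wreath Zgroup A}) : generating T ->
  exists c' C' : R, [/\ 0 < c', 0 < C' & forall n,
    c' * n%:R `^ ((1 + alpha) / 2)
    <= drift T (uniform_on R (wreath_generators S)) n
    <= C' * n%:R `^ ((1 + alpha) / 2)].
Proof.
move=> genT; have [c1 [c2 upT]] := wreath_length_upper genS genT.
have [c3 lowT] := wreath_length_lower genS genT.
have [a0 a1] := andP alpha01.
have r_gt0 : 0 < (size S)%:R :> R by rewrite ltr0n.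
pose r : R := (size S)%:R; pose p := r / (r + 2); pose B := 2 * (r + 1) / p.
have p_gt0 : 0 < p by rewrite divr_gt0 // addr_gt0.
have B_gt0 : 0 < B by rewrite divr_gt0 // mulr_gt0 // addr_gt0.
pose k := B `^ alpha * (p / (2 * B)).
have k_gt0 : 0 < k by rewrite mulr_gt0 ?powR_gt0 // divr_gt0 // mulr_gt0.
have c3_gt0 : 0 < c3.+1%:R :> R by rewrite ltr0n.
(* The 3 bounds the range, [2s + 1 <= 3s], and the 4 comes from [avg_profile_upper]; the successor
   on [c3] and the final [+ 1] ensure positivity. *)
exists (c * k / c3.+1%:R), (c1%:R * 3 + c2%:R * (C * 4) + 1); split.
- by rewrite divr_gt0 // mulr_gt0.
- by rewrite ltr_wpDl // addr_ge0 // mulr_ge0 // mulr_ge0 // ltW.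
(* At [n = 0] both sides vanish since the exponent is positive; the estimates for [s = sqrt n]
   require [s >= 1]. *)
case=> [|n]; rewrite wreath_drift.
  rewrite avg0 /config big_nil word_length1 powR0 ?mulr0 ?lexx //.
  by rewrite gt_eqF // divr_gt0 // addr_gt0.
rewrite powR_half //; move: (n.+1) (ltn0Sn n) => {}n n_gt0; set s := Num.sqrt _.
have n_sqr : n%:R = s ^+ 2 by rewrite sqr_sqrtr.
have s_ge1 : 1 <= s by rewrite -sqrtr1 ler_sqrt ?ler1n ?ltr0n.
have s_gt0 : 0 < s by apply: lt_le_trans s_ge1.
have sa_ge1 : 1 <= s `^ alpha by rewrite -(powRr0 s) ler_powR // ltW.
have profile_lower := avg_profile_lower S_gt0 alpha01 s_ge1 n_sqr.
have profile_upper := avg_profile_upper S_gt0 alpha01 s_ge1 n_sqr.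
have lag_upper := avg_lag S_gt0 s_ge1 n_sqr.
have lamps_lower : c * (k * (s `^ alpha * s)) <= E n (fun w => (lamps n w)%:R).
  rewrite avg_lamps.
  apply: le_trans (ler_wpM2l (ltW c_gt0) profile_lower) _.
  rewrite -avgZ; apply: le_avg => w _; rewrite mulr_sumr.
  by apply: ler_sum => x _; case/andP: (growthS (count_mem x (switches w))).
have lamps_upper : E n (fun w => (lamps n w)%:R) <= C * (4 * (s `^ alpha * s)).
  rewrite avg_lamps.
  apply: le_trans (ler_wpM2l (ltW C_gt0) profile_upper).
  rewrite -avgZ; apply: le_avg => w _; rewrite mulr_sumr.
  by apply: ler_sum => x _; case/andP: (growthS (count_mem x (switches w))).
apply/andP; split.
  rewrite mulrAC ler_pdivrMr //.
  rewrite -mulrA; apply: le_trans lamps_lower _.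
  rewrite mulrC -avgZ; apply: le_avg => w _; rewrite -natrM ler_nat.
  by apply: leq_trans (lowT n (config w)) _; rewrite leq_mul2r leqnSn orbT.
apply: (@le_trans _ _ (E n (fun w => c1%:R *
    ((lag true w)%:R + (lag false w)%:R + 1) + c2%:R * (lamps n w)%:R))).
  apply: le_avg => w sw.
  by rewrite -natrD natr1 -!natrM -natrD ler_nat; exact: upT.
rewrite avgD !avgZ !avgD avg_cst //.
(* The range, of order [s], is absorbed by the lamp term because [s^alpha >= 1]. *)
have s_le : s <= s `^ alpha * s by rewrite ler_peMl // ltW.
rewrite mulrDl mul1r mulrDl -2!mulrA.
apply: ler_wpDr; first by rewrite mulr_ge0 // ltW // (lt_le_trans ltr01).
rewrite lerD // ler_wpM2l //; last by rewrite -mulrA.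
by have := lag_upper true; have := lag_upper false; lra.
Qed.

End WreathGrowth.

Lemma drift_growth_wreath (R : realType) (A : groupType) (alpha : R) :
    0 < alpha < 1 -> drift_growth A alpha ->
  drift_growth (wreath Zgroup A) ((1 + alpha) / 2).
Proof.
move=> alpha01 [S [symS genS S_gt0 growth]].
have [c [C [c_gt0 C_gt0 growthS]]] := growth S genS.
exists (wreath_generators S); split.
- exact: wreath_generators_symmetric.
- exact: wreath_generators_generating.
- by rewrite (perm_size (perm_wreath_generators S)).
- by move=> T genT; exact: (wreath_drift_growth _ _ _ c_gt0 C_gt0).
Qed.

(** * Base case: the simple random walk on the integers *)

Section Integers.
Variable R : realType.

Definition unit_steps : seq Zgroup := [:: 1 : int; -1 : int].

Definition Zgenerators : {fset Zgroup} := [fset s in unit_steps]%fset.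

Definition endpoint (w : seq Zgroup) : int := (\prod_(s <- w) s)%g.

Lemma endpoint0 : endpoint [::] = 0.
Proof. by rewrite /endpoint big_nil. Qed.

Lemma endpoint_cons s w : endpoint (s :: w) = (s : int) + endpoint w.
Proof. by rewrite /endpoint big_cons. Qed.

Local Notation E n phi := (avg unit_steps n phi : R).

Lemma endpoint_step (f : int -> R) w :
  (\sum_(s <- unit_steps) f (endpoint (s :: w))) / (size unit_steps)%:R =
  (f (1 + endpoint w) + f (-1 + endpoint w)) / 2.
Proof. by rewrite !big_cons big_nil addr0 !endpoint_cons. Qed.

Lemma avg_endpoint_sqr n : E n (fun w => (endpoint w)%:~R ^+ 2) = n%:R.
Proof.
elim: n => [|n IHn]; first by rewrite avg0 endpoint0 mulr0z expr0n.
rewrite avgS -natr1 -IHn -[X in _ = _ + X](@avg_cst R _ unit_steps n) // -avgD.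
apply: eq_avg => w; rewrite (@endpoint_step (fun x => x%:~R ^+ 2)) !intrD.
by field.
Qed.

(** One step adds [6 X^2 + 1] to the mean of [X^4], that is [6n + 1] on average, below
    [3(n + 1)^2 - 3n^2 = 6n + 3]. *)
Lemma avg_endpoint_quartic n :
  E n (fun w => (endpoint w)%:~R ^+ 4) <= 3 * n%:R ^+ 2.
Proof.
elim: n => [|n IHn]; first by rewrite avg0 endpoint0 mulr0z !expr0n mulr0.
pose psi (w : seq Zgroup) : R := 6 * (endpoint w)%:~R ^+ 2 + 1.
apply: le_trans (avg_step_le (psi := psi) _ _) _.
  move=> w; rewrite (@endpoint_step (fun x => x%:~R ^+ 4)) /psi !intrD.
  by rewrite le_eqVlt; apply/orP; left; apply/eqP; field.
rewrite /psi avgD avgZ avg_endpoint_sqr avg_cst // -natr1.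
have := ler0n R n; nra.
Qed.

Lemma perm_Zgenerators : perm_eq Zgenerators unit_steps.
Proof. by apply: uniq_perm => [||g]; rewrite ?fset_uniq ?in_fset. Qed.

Lemma Zgenerators_generating : generating Zgenerators.
Proof.
pose LL (g : Zgroup) (n : nat) :=
  exists2 w, represents Zgenerators w g & size w = n.
have LLletter s : s \in unit_steps -> LL s 1%N.
  move=> sS; exists [:: s] => //; split; last by rewrite big_seq1.
  by rewrite /= in_fset /= sS.
suff key (x : Zgroup) : LL x (1 * absz (x : int))%N.
  by move=> x; case: (key x) => w; exists w.
apply: (int_morphism_bound (LL := LL) (h := id)) => //.
- by exists [::] => //; exact: represents1.
- move=> g h m n [v rv <-] [w rw <-].
  by exists (v ++ w); [exact: representsM|rewrite size_cat].
- exact: LLletter.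
- exact: LLletter.
Qed.

(** The upper bound comes from the second moment; the lower bound also uses the fourth, which
    prevents the second from being carried by rare large values. *)
Lemma drift_growth_Z : drift_growth (R := R) Zgroup 2^-1.
Proof.
exists Zgenerators; split.
- move=> s; rewrite !in_fset !inE => /orP[] /eqP -> //.
- exact: Zgenerators_generating.
- by rewrite (perm_size perm_Zgenerators).
move=> T genT.
have [c1 dom] := word_length_dominates (fun x : Zgroup => absz (x : int)) genT.
have lowT (x : Zgroup) : (absz (x : int) <= c1 * word_length T x)%N.
  have absD (y z : int) : (absz (y + z)%R <= absz y + absz z)%N by lia.
  by apply: (dom (fun x : Zgroup => absz (x : int))) => // y z; exact: absD.
pose c2 := (word_length T (1%:Z : Zgroup) + word_length T (- 1%:Z : Zgroup))%N.
have upT (x : Zgroup) : (word_length T x <= c2 * absz (x : int))%N.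
  pose LL (g : Zgroup) n := (word_length T g <= n)%N.
  apply: (int_morphism_bound (LL := LL) (h := id)).
  - by [].
  - by rewrite /LL word_length1.
  - move=> g h m n hm hn.
    exact: leq_trans (word_lengthM _ _ genT) (leq_add hm hn).
  - exact: leq_addr.
  - exact: leq_addl.
have c1_gt0 : 0 < c1.+1%:R :> R by rewrite ltr0n.
exists ((8 * c1.+1%:R)^-1), (c2.+1%:R); split => [||n].
- by rewrite invr_gt0 mulr_gt0.
- by rewrite ltr0n.
rewrite drift_avg (avg_perm _ _ perm_Zgenerators) powR12_sqrt //.
case: n => [|n].
  by rewrite avg0 big_nil word_length1 sqrtr0 !mulr0 lexx.
move: (n.+1) (ltn0Sn n) => {}n n_gt0; set s := Num.sqrt _.
have n_sqr : n%:R = s ^+ 2 by rewrite sqr_sqrtr.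
have s_gt0 : 0 < s by rewrite sqrtr_gt0 ltr0n.
apply/andP; split.
  rewrite mulrC ler_pdivrMr ?mulr_gt0 // mulrC -mulrA -avgZ -ler_pdivrMl //.
  (* With [k = 1 / (2s)] and [u = |X|], the inequality [v - v^3 <= 1] at [v = k u] gives
     [k u^2 - k^3 u^4 <= u]. The mean of the left side is at least [s / 2 - 3s / 8 = s / 8], whence
     the 8 in the constant. *)
  apply: (@le_trans _ _ (E n (fun w => (2 * s)^-1 * (endpoint w)%:~R ^+ 2
      - (2 * s)^-1 ^+ 3 * (endpoint w)%:~R ^+ 4))).
    rewrite avgD avgN !avgZ avg_endpoint_sqr.
    apply: (@le_trans _ _ ((2 * s)^-1 * n%:R
        - (2 * s)^-1 ^+ 3 * (3 * n%:R ^+ 2))).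
      rewrite n_sqr le_eqVlt; apply/orP; left; apply/eqP; field.
      by rewrite gt_eqF.
    rewrite lerB // ler_wpM2l ?avg_endpoint_quartic // exprn_ge0 //.
    by rewrite invr_ge0 mulr_ge0 // ltW.
  apply: le_avg => w _.
  apply: (@le_trans _ _ (absz (endpoint w))%:R); last first.
    rewrite -natrM ler_nat; apply: leq_trans (lowT _) _.
    by rewrite leq_mul2r leqnSn orbT.
  rewrite natr_absz intr_norm; set x : R := (endpoint w)%:~R.
  rewrite -(real_normK (num_real x)) (exprM x 2 2) -(real_normK (num_real x)).
  set u := `|x|; have u0 : 0 <= u by exact: normr_ge0.
  set k := (2 * s)^-1; have k0 : 0 <= k by rewrite invr_ge0 mulr_ge0 // ltW.
  have -> : k * u ^+ 2 - k ^+ 3 * (u ^+ 2) ^+ 2 = u * (k * u - (k * u) ^+ 3).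
    by ring.
  have : 0 <= k * u by rewrite mulr_ge0.
  move: (k * u) => v v0; rewrite ler_piMr //.
  by have [v1|v1] := leP v 1; nra.
apply: (@le_trans _ _ (E n (fun w => c2.+1%:R * `|(endpoint w)%:~R|))).
  apply: le_avg => w _; rewrite -intr_norm -natr_absz -natrM ler_nat.
  by apply: leq_trans (upT _) _; rewrite leq_mul2r leqnSn orbT.
rewrite avgZ ler_wpM2l //; apply: avg_le_sqrt => //.
under eq_avg do rewrite real_normK ?num_real //.
by rewrite avg_endpoint_sqr n_sqr.
Qed.

End Integers.

Lemma drift_growth_G (R : realType) i :
  drift_growth (R := R) (G i.+1) (1 - (2 ^+ i.+1)^-1).
Proof.
elim: i => [|i IHi].
  rewrite (_ : 1 - _ = 2^-1); first exact: drift_growth_Z.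
  by rewrite expr1; field.
rewrite (_ : 1 - _ = (1 + (1 - (2 ^+ i.+1)^-1)) / 2).
  apply: drift_growth_wreath => //.
  have p1 : 1 < 2 ^+ i.+1 :> R by rewrite exprn_egt1 // ltr1n.
  have p0 : 0 < 2 ^+ i.+1 :> R by rewrite exprn_gt0.
  by rewrite subr_gt0 invf_lt1 // p1 gtrBl invr_gt0.
by rewrite (exprS 2 i.+1); field; rewrite expf_neq0.
Qed.

Theorem theorem1 (R : realType) (i : nat) (hi : (1 <= i)%N) :
  exists mu : G i -> R, simple_random_walk mu /\
    forall T : {fset G i}, generating T ->
      asymp (drift T mu) (fun n : nat => n%:R `^ (1 - (2 ^+ i)^-1)).
Proof.
case: i hi => // i _; have [S [symS genS _ growth]] := drift_growth_G R i.
exists (uniform_on R S); split; first by exists S.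
move=> T /growth[c [C [c_gt0 C_gt0 bounds]]]; exists c, C; split => //.
exact: nearW.
Qed.
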